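(* Let $\gamma$ be a (nonconstant) $\tau$-periodic trajectory of an autonomous Lagrangian system which is nondegenerate in the autonomous sense (it has only two unit multipliers), and let $\gamma_\alpha$ be the family of $\tau(\alpha)$-periodic trajectories with $\gamma_0=\gamma$, $\tau(0)=\tau$, and energies $E(\alpha)$. Suppose that $dE/d\tau\ne0$ at $\gamma$. Then, at $\alpha=0$, $$(-1)^{\operatorname{ind} b}=-\operatorname{sign}\bigl(\tau'(\alpha)E'(\alpha)\bigr)=-\operatorname{sign}\frac{dE}{d\tau}.$$
   Context: The Lagrangian $\mathscr{L}(x,\dot x)$ on $TM$ is smooth with $\mathscr{L}_{\dot x\dot x}$ positive definite; the energy is $\mathscr{H}=\langle\mathscr{L}_{\dot x},\dot x\rangle-\mathscr{L}$. $P:W\to W$ is the linear Poincaré (monodromy) map of $\gamma$: the linearization at the initial phase point of the time-$\tau$ map of the Lagrangian flow on the $2m$-dimensional phase space $TM\cong T^*M$ (via $p=\mathscr{L}_{\dot x}$); multipliers are eigenvalues of $P$; ''only two unit multipliers'' means the eigenvalue $1$ has algebraic multiplicity $2$. The variational system has the $\tau$-periodic solution $\dot\gamma$. Then, as proved by Poincaré, there is a one-parameter smooth family $\gamma_\alpha$ of $\tau(\alpha)$-periodic trajectories with $\gamma_0=\gamma$, $\tau(0)=\tau$; $E(\alpha)=\mathscr{H}|_{\gamma_\alpha}$, and $dE/d\tau=E'(0)/\tau'(0)$ (it is understood that $\tau'(0)\ne0$). $N=\operatorname{Ker}(P-I)^2$ is the generalized unit eigenspace, $\omega=dx\wedge dp$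 is the symplectic form on $W$ (i.e. $\omega((\delta x,\delta p),(\delta x',\delta p'))=\langle\delta p',\delta x\rangle-\langle\delta p,\delta x'\rangle$), $b(v,w)=\omega((P-I)v,w)$ is a symmetric bilinear form on $N$, and $\operatorname{ind} b$ is its negative index. *)

(* Defs.v *)
From HB Require Import structures.
From mathcomp Require Import all_boot all_order all_algebra.
From mathcomp Require Import all_classical all_reals all_analysis.

Set Implicit Arguments.
Unset Strict Implicit.
Unset Printing Implicit Defensive.

Import Order.TTheory GRing.Theory Num.Theory.
Import numFieldNormedType.Exports.

Local Open Scope classical_set_scope.
Local Open Scope ring_scope.

(* Class C^k on an open set of a finite-dimensional space: f is C^(k+1) iff it
   is differentiable and all its directional derivatives are C^k. *)
Fixpoint Ck (R : realType) (V W : normedModType R) (k : nat)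
    (A : set V) (f : V -> W) : Prop :=
  match k with
  | 0 => forall x, A x -> {for x, continuous f}
  | k'.+1 => (forall x, A x -> differentiable f x) /\
             (forall v : V, Ck k' A (fun x => 'D_v f x))
  end.

Definition smooth_on (R : realType) (V W : normedModType R)
    (A : set V) (f : V -> W) : Prop := forall k, Ck k A f.

(* [cmap] and [cinv] are total functions; only their values on [cdom] and on
   [cmap @` cdom] are meaningful. *)
Record chart (R : realType) (M : topologicalType) (m : nat) := Chart {
  cdom : set M;
  cmap : M -> 'rV[R]_m;
  cinv : 'rV[R]_m -> M;
  chart_open_dom : open cdom;
  chart_open_image : open (cmap @` cdom);
  chart_cancel : forall x, cdom x -> cinv (cmap x) = x;
  chart_continuous : forall x, cdom x -> {for x, continuous cmap};
  chart_inv_continuous :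
    forall q, (cmap @` cdom) q -> {for q, continuous cinv} }.

Definition transition (R : realType) (M : topologicalType) (m : nat)
  (a b : chart R M m) : 'rV[R]_m -> 'rV[R]_m := cmap b \o cinv a.

Record manifold (R : realType) (m : nat) := Manifold {
  mpoint :> topologicalType;
  mindex : Type;
  mchart : mindex -> chart R mpoint m;
  manifold_hausdorff : hausdorff_space mpoint;
  manifold_second_countable : @second_countable mpoint;
  manifold_cover : forall x : mpoint, exists i, cdom (mchart i) x;
  manifold_smooth : forall i j,
    smooth_on (cmap (mchart i) @` (cdom (mchart i) `&` cdom (mchart j)))
      (transition (mchart i) (mchart j)) }.

Definition dot (R : realType) (m : nat) (u v : 'rV[R]_m) : R :=
  \sum_k u 0 k * v 0 k.

Definition grad_x (R : realType) (m : nat) (L : 'rV[R]_m -> 'rV[R]_m -> R)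
    (x v : 'rV[R]_m) : 'rV[R]_m :=
  \row_k 'D_(delta_mx 0 k) (fun y => L y v) x.

Definition grad_v (R : realType) (m : nat) (L : 'rV[R]_m -> 'rV[R]_m -> R)
    (x v : 'rV[R]_m) : 'rV[R]_m :=
  \row_k 'D_(delta_mx 0 k) (fun u => L x u) v.

Definition hess_v (R : realType) (m : nat) (L : 'rV[R]_m -> 'rV[R]_m -> R)
    (x v : 'rV[R]_m) : 'M[R]_m :=
  \matrix_(k, l) 'D_(delta_mx 0 l) (fun u => grad_v L x u 0 k) v.

Definition local_energy (R : realType) (m : nat)
    (L : 'rV[R]_m -> 'rV[R]_m -> R) (x v : 'rV[R]_m) : R :=
  dot (grad_v L x v) v - L x v.

(* A function on TM is given by its expressions (x, v) |-> L i x v in the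
   charts of the atlas; v is the coordinate vector of a tangent vector, which
   changes by the differential of the transition map. *)
Record lagrangian (R : realType) (m : nat) (M : manifold R m) := Lagrangian {
  lag :> mindex M -> 'rV[R]_m -> 'rV[R]_m -> R;
  lagrangian_compatible : forall i j (q : M) (v : 'rV[R]_m),
    cdom (mchart i) q -> cdom (mchart j) q ->
    lag j (cmap (mchart j) q)
      ('d (transition (mchart i) (mchart j)) (cmap (mchart i) q) v) =
    lag i (cmap (mchart i) q) v;
  lagrangian_smooth : forall i,
    smooth_on [set z : 'rV[R]_m * 'rV[R]_m |
                (cmap (mchart i) @` cdom (mchart i)) z.1]
      (fun z => lag i z.1 z.2 : R);
  lagrangian_posdef : forall i (q : M) (v h : 'rV[R]_m),
    cdom (mchart i) q -> h != 0 ->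
    0 < dot (h *m hess_v (lag i) (cmap (mchart i) q) v) h }.

Definition coord (R : realType) (m : nat) (M : manifold R m) (i : mindex M)
  (c : R -> M) : R -> 'rV[R]_m := cmap (mchart i) \o c.

Definition momentum (R : realType) (m : nat) (M : manifold R m)
    (L : lagrangian M) (i : mindex M) (c : R -> M) (t : R) : 'rV[R]_m :=
  grad_v (L i) (coord i c t) (derive1 (coord i c) t).

(* The interval J is meant to be open; the last condition is the
   Euler-Lagrange equation. *)
Definition trajectory (R : realType) (m : nat) (M : manifold R m)
    (L : lagrangian M) (J : set R) (c : R -> M) : Prop :=
  forall t, J t -> {for t, continuous c} /\
    forall i, cdom (mchart i) (c t) ->
      [/\ derivable (coord i c) t 1,
          derivable (derive1 (coord i c)) t 1 &
          is_derive t (1 : R) (momentum L i c)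
            (grad_x (L i) (coord i c t) (derive1 (coord i c) t))].

Definition periodic_trajectory (R : realType) (m : nat) (M : manifold R m)
    (L : lagrangian M) (T : R) (c : R -> M) : Prop :=
  [/\ trajectory L setT c, 0 < T & forall t, c (t + T) = c t].

(* Canonical coordinates (x, p) of the phase point of c at time t. *)
Definition phase (R : realType) (m : nat) (M : manifold R m)
    (L : lagrangian M) (i : mindex M) (c : R -> M) (t : R) : 'rV[R]_(m + m) :=
  row_mx (coord i c t) (momentum L i c t).

(* Near z0, Phi is the time-T map of the Lagrangian flow on phase space, read
   in chart i: its graph is the set of pairs (initial phase point, final phase
   point) of trajectories of duration T. *)
Definition time_map (R : realType) (m : nat) (M : manifold R m)
    (L : lagrangian M) (i : mindex M) (T : R) (z0 : 'rV[R]_(m + m))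
    (Phi : 'rV[R]_(m + m) -> 'rV[R]_(m + m)) : Prop :=
  \forall z \near z0, forall z', z' = Phi z <->
    exists (c : R -> M) (e : R),
      [/\ 0 < e,
          trajectory L [set t | - e < t < T + e] c,
          cdom (mchart i) (c 0) /\ phase L i c 0 = z &
          cdom (mchart i) (c T) /\ phase L i c T = z'].

(* P is the matrix, acting on row vectors, of the linear Poincare map of the
   T-periodic trajectory c, in the canonical coordinates of chart i. *)
Definition linear_poincare (R : realType) (m : nat) (M : manifold R m)
    (L : lagrangian M) (i : mindex M) (T : R) (c : R -> M)
    (P : 'M[R]_(m + m)) : Prop :=
  cdom (mchart i) (c 0) /\
  exists Phi : 'rV[R]_(m + m) -> 'rV[R]_(m + m),
    [/\ time_map L i T (phase L i c 0) Phi,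
        differentiable Phi (phase L i c 0) &
        P = 'J Phi (phase L i c 0)].

Definition nondegenerate_autonomous (R : realType) (n : nat) (P : 'M[R]_n) :
  Prop := mup 1 (char_poly P) = 2%N.

(* The smooth family of T(a)-periodic trajectories c_a, |a| < e, with energies
   E(a), through the T0-periodic trajectory c0. *)
Record periodic_family (R : realType) (m : nat) (M : manifold R m)
    (L : lagrangian M) (c0 : R -> M) (T0 : R) (e : R)
    (c : R -> R -> M) (T E : R -> R) : Prop := PeriodicFamily {
  family_radius : 0 < e;
  family_continuous : forall a t : R, `|a| < e ->
    {for (a, t), continuous (fun z : R * R => c z.1 z.2)};
  family_smooth : forall i,
    smooth_on [set z : R * R | `|z.1| < e /\ cdom (mchart i) (c z.1 z.2)]
      (fun z => coord i (c z.1) z.2);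
  family_period_smooth : smooth_on [set a : R | `|a| < e] T;
  family_periodic : forall a, `|a| < e -> periodic_trajectory L (T a) (c a);
  family_energy : forall a t i, `|a| < e -> cdom (mchart i) (c a t) ->
    E a = local_energy (L i) (coord i (c a) t) (derive1 (coord i (c a)) t);
  family_init : c 0 = c0;
  family_init_period : T 0 = T0 }.

(* omega = dx /\ dp *)
Definition omega (R : realType) (m : nat) (v w : 'rV[R]_(m + m)) : R :=
  dot (rsubmx w) (lsubmx v) - dot (rsubmx v) (lsubmx w).

Definition unit_eigenspace (R : realType) (n : nat) (P : 'M[R]_n) : 'M[R]_n :=
  kermx ((P - 1%:M) *m (P - 1%:M)).

Definition bform (R : realType) (m : nat) (P : 'M[R]_(m + m))
  (v w : 'rV[R]_(m + m)) : R := omega (v *m (P - 1%:M)) w.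

(* Negative index of the form b on the row space of N: the largest dimension of
   a subspace of N on which b is negative definite. *)
Definition neg_index (R : realType) (n : nat) (N : 'M[R]_n)
    (b : 'rV[R]_n -> 'rV[R]_n -> R) : nat :=
  (\max_(k < n.+1 | `[< exists S : 'M[R]_n,
      [/\ (S <= N)%MS, \rank S = k &
          forall v : 'rV[R]_n, (v <= S)%MS -> (v != 0 -> b v v < 0)%R] >]) k)%N.

(* Main.v *)
Require Import Defs.
From mathcomp Require Import all_boot all_order all_algebra.
From mathcomp Require Import all_classical all_reals all_analysis.
From mathcomp Require Import ring.

(** Let zeta(a, t) be the phase point, in canonical coordinates, of the a-th
    trajectory of the family at time t, let u and w be its derivatives at (0, 0)
    with respect to t and to a, and let Phi be the time-tau(0) map of the flow.
    Near (0, 0),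
      Phi (zeta(a, t)) = zeta(a, t + tau(0)) = zeta(a, t + tau(0) - tau(a)),
    the second equality because the a-th trajectory is tau(a)-periodic.
    Differentiating it at (0, 0), with P acting on row vectors, gives
      u (P - I) = 0   and   w (P - I) = - tau'(0) u
    ([poincare_time_derivative], [poincare_parameter_derivative]).  By the
    Euler-Lagrange equation u is the Hamiltonian vector field, so that omega(u, w)
    is the derivative of the energy along w: omega(u, w) = E'(0)
    ([derive_energy]).  As E'(0) is nonzero, u and w are linearly independent;
    both lie in N = Ker (P - I)^2, and dim N is at most the algebraic
    multiplicity 2 of the eigenvalue 1 ([rank_unit_eigenspace]), so they span N.
    On N,
      b(x u + y w, x u + y w) = - y^2 tau'(0) E'(0),
    hence ind b is 1 if tau'(0) E'(0) > 0 and 0 otherwise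
    ([neg_index_monodromy]). *)

Set Implicit Arguments.
Unset Strict Implicit.
Unset Printing Implicit Defensive.

Import Order.TTheory GRing.Theory Num.Theory.
Import numFieldNormedType.Exports.

Local Open Scope classical_set_scope.
Local Open Scope ring_scope.

(** * Multiplicity of the unit eigenvalue *)

(** The rows of V span a P-stable subspace, on which P acts by A. *)
Lemma char_poly_stable_dvd (F : fieldType) (r n : nat) (V : 'M[F]_(r, n))
    (P : 'M[F]_n) (A : 'M[F]_r) :
  row_free V -> V *m P = A *m V -> char_poly A %| char_poly P.
Proof.
move=> Vfree VP.
have [s def_n] : exists s, n = (r + s)%N.
  exists (n - r)%N; rewrite subnKC //.
  by move: Vfree; rewrite /row_free => /eqP <-; exact: rank_leq_col.
subst n.
(* B completes the rows of V to a basis of the whole space; in this basis P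
   becomes a block lower triangular matrix Q with upper left block A. *)
pose B := block_mx (col_ebase V) 0 0 1%:M *m row_ebase V.
have uB : usubmx B = V.
  rewrite /B -{1}(vsubmxK (row_ebase V)) mul_block_col col_mxKu mul0mx addr0.
  rewrite -{3}(mulmx_ebase V) (eqP Vfree) -{2}(vsubmxK (row_ebase V)).
  have -> : pid_mx r = row_mx 1%:M 0 :> 'M[F]_(r, r + s).
    by rewrite pid_mx_row.
  by rewrite -mulmxA mul_row_col mul1mx mul0mx addr0.
have Bunit : B \in unitmx.
  rewrite unitmx_mul row_ebase_unit andbT unitmxE det_lblock det1 mulr1.
  by rewrite -unitmxE col_ebase_unit.
pose Q := B *m P *m invmx B.
have QB : Q *m B = B *m P by rewrite mulmxKV.
have uQ : usubmx Q = row_mx A 0.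
  apply: (row_free_inj (A := B)); first by rewrite row_free_unit.
  rewrite /= mul_usub_mx QB -mul_usub_mx uB VP -[in RHS](vsubmxK B).
  by rewrite mul_row_col mul0mx addr0 uB.
have PQ : char_poly P = char_poly Q.
  pose C := map_mx polyC B.
  have detC : \det C != 0.
    by rewrite det_map_mx polyC_eq0 -unitfE -unitmxE.
  apply: (mulfI detC); rewrite /char_poly -det_mulmx mulrC -det_mulmx.
  rewrite /char_poly_mx mulmxBr mulmxBl -!map_mxM /= QB.
  by rewrite scalar_mxC.
rewrite PQ /char_poly /char_poly_mx -{1}(submxK Q).
rewrite (_ : ulsubmx Q = A); last by rewrite /ulsubmx uQ row_mxKl.
rewrite (_ : ursubmx Q = 0); last by rewrite /ursubmx uQ row_mxKr.
rewrite map_block_mx scalar_mx_block opp_block_mx add_block_mx.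
by rewrite map_mx0 oppr0 addr0 det_lblock dvdp_mulr.
Qed.

(** With D = A - I and D^2 = 0, the product of (X - 1) I - D, whose determinant
    is the characteristic polynomial of A, and of (X - 1) I + D is (X - 1)^2 I. *)
Lemma char_poly_sub1_sqr0 (F : fieldType) (r : nat) (A : 'M[F]_r) :
  (A - 1%:M) *m (A - 1%:M) = 0 -> char_poly A = ('X - 1%:P) ^+ r.
Proof.
move=> A2.
have dvA : char_poly A %| ('X - 1%:P) ^+ (2 * r)%N.
  pose D := map_mx polyC (A - 1%:M).
  have -> : ('X - 1%:P) ^+ (2 * r)%N
      = char_poly A * \det (('X - 1%:P)%:M + D).
    have -> : char_poly A = \det (('X - 1%:P)%:M - D).
      congr (\det _); rewrite /char_poly_mx /D map_mxB map_scalar_mx /=.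
      by rewrite raddfB opprB /= addrA subrK.
    rewrite -det_mulmx mulmxDr !mulmxBl.
    rewrite -map_mxM A2 map_mx0 subr0. rewrite (scalar_mxC _ D) subrK.
    by rewrite -scalar_mxM det_scalar exprM.
  exact: dvdp_mulr.
have /dvdp_exp_XsubCP[k lek eqpk] := dvA.
have : char_poly A = ('X - 1%:P) ^+ k.
  by apply/eqP; rewrite -eqp_monic ?char_poly_monic ?monic_exp ?monicXsubC.
move=> e; have := size_char_poly A; rewrite e size_exp_XsubC => -[kr].
by rewrite -kr.
Qed.

(** The dimension of Ker (P - I)^2 is at most the algebraic multiplicity of the
    eigenvalue 1. *)
Lemma rank_unit_eigenspace (R : realType) (n : nat) (P : 'M[R]_n) :
  (\rank (unit_eigenspace P) <= mup 1 (char_poly P))%N.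
Proof.
set N := unit_eigenspace P; set D := P - 1%:M.
have D2 : row_base N *m (D *m D) = 0.
  by apply/eqP; rewrite -sub_kermx eq_row_base.
have stab : (row_base N *m D <= row_base N)%MS.
  rewrite (eqmxMr D (eq_row_base N)) !eq_row_base sub_kermx.
  have ND : N *m (D *m D) = 0 by apply/eqP; rewrite -sub_kermx.
  by rewrite mulmxA -(mulmxA N D D) ND mul0mx.
have /submxP[A' VA'] := stab.
have Vfree := row_base_free N.
have A'2 : A' *m A' = 0.
  apply: (row_free_inj Vfree); rewrite /= mul0mx -mulmxA -VA' mulmxA.
  by rewrite -VA' -mulmxA.
have VA : row_base N *m P = (A' + 1%:M) *m row_base N.
  by rewrite mulmxDl mul1mx -VA' /D mulmxBr mulmx1 subrK.
rewrite mup_geq ?monic_neq0 ?char_poly_monic //.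
rewrite -(char_poly_sub1_sqr0 (A := A' + 1%:M)) ?addrK //.
exact: char_poly_stable_dvd VA.
Qed.

Lemma plane_unit_eigenspace (R : realType) (n : nat) (P : 'M[R]_n)
    (u w : 'rV[R]_n) :
  nondegenerate_autonomous P -> row_free (col_mx u w) ->
  u *m (P - 1%:M) = 0 -> w *m (P - 1%:M) *m (P - 1%:M) = 0 ->
  (unit_eigenspace P :=: col_mx u w)%MS.
Proof.
move=> nd free uP wP.
have sub : (col_mx u w <= unit_eigenspace P)%MS.
  by rewrite sub_kermx mul_col_mx !mulmxA uP mul0mx wP col_mx0.
apply/eqmx_sym/eqmxP; rewrite -(geq_leqif (mxrank_leqif_eq sub)) (eqP free).
by rewrite (leq_trans (rank_unit_eigenspace P)) // nd.
Qed.

(** On the plane spanned by u and w, the form b is beta times the square of the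
    second coordinate, so its negative index is 1 if beta < 0 and 0 otherwise. *)
Lemma neg_index_plane (R : realType) (n : nat) (N : 'M[R]_n)
    (b : 'rV[R]_n -> 'rV[R]_n -> R) (u w : 'rV[R]_n) (beta : R) :
  row_free (col_mx u w) -> (N :=: col_mx u w)%MS ->
  (forall a c : R, b (a *: u + c *: w) (a *: u + c *: w) = c ^+ 2 * beta) ->
  neg_index N b = (beta < 0)%R :> nat.
Proof.
move=> free defN bE.
have inN v : (v <= N)%MS -> exists a c : R, v = a *: u + c *: w.
  rewrite defN => /submxP[d ->].
  exists (lsubmx d 0 0), (rsubmx d 0 0).
  rewrite -{1}(hsubmxK d) mul_row_col {1}[lsubmx d]mx11_scalar.
  by rewrite {1}[rsubmx d]mx11_scalar !mul_scalar_mx.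
have rN : \rank N = 2%N by rewrite defN (eqP free).
have u_neq0 : u != 0.
  apply: contraTneq free => ->.
  by rewrite /row_free -addsmxE adds0mx neq_ltn ltnS rank_leq_row.
have w_neq0 : w != 0.
  apply: contraTneq free => ->.
  by rewrite /row_free -addsmxE addsmx0 neq_ltn ltnS rank_leq_row.
have buu : b u u = 0.
  by have := bE 1 0; rewrite scale1r scale0r addr0 => ->; rewrite expr0n mul0r.
have upper k : (exists S : 'M[R]_n, [/\ (S <= N)%MS, \rank S = k &
    forall v, (v <= S)%MS -> v != 0 -> b v v < 0]) -> (k <= (beta < 0)%R)%N.
  move=> [S [SN rS neg]].
  (* A negative definite subspace contains a vector other than 0, which forces
     beta < 0; it is not the whole plane, as b u u = 0. *)
  case: (posnP k) => [-> //|k_gt0].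
  have [v vS v_neq0] : exists2 v : 'rV[R]_n, (v <= S)%MS & v != 0.
    by apply/rowV0Pn; rewrite -mxrank_eq0 rS -lt0n.
  have beta_lt0 : beta < 0.
    have := neg v vS v_neq0.
    have [a [c ->]] := inN _ (submx_trans vS SN).
    rewrite bE; apply: contraTT; rewrite -!leNgt => beta_ge0.
    by rewrite mulr_ge0 // sqr_ge0.
  rewrite beta_lt0 leqNgt; apply/negP => k_gt1.
  have uS : (u <= S)%MS.
    have /eqmxP : (S == N)%MS; last first.
      by move=> ->; rewrite defN -addsmxE addsmxSl.
    by rewrite -(geq_leqif (mxrank_leqif_eq SN)) rN rS.
  by have := neg u uS u_neq0; rewrite buu ltxx.
apply/eqP; rewrite eqn_leq; apply/andP; split.
  by apply/bigmax_leqP => k /asboolP; exact: upper.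
case: (ltP beta 0) => // beta_lt0.
have n1 : (1 < n.+1)%N by rewrite ltnS (leq_trans _ (rank_leq_row N)) ?rN.
apply: (bigop.bigmax_sup (Ordinal n1)) => //.
apply/asboolP; exists <<w>>%MS; split.
- by rewrite genmxE defN -addsmxE addsmxSr.
- by rewrite genmxE rank_rV w_neq0.
- move=> v; rewrite genmxE => /sub_rVP[c ->] cw.
  have := bE 0 c; rewrite scale0r add0r => ->.
  rewrite nmulr_llt0 // exprn_even_gt0 //=.
  by apply: contraNneq cw => ->; rewrite scale0r.
Qed.

(** * The symplectic form and its restriction to the unit eigenspace *)

Lemma omega_self (R : realType) (m : nat) (v : 'rV[R]_(m + m)) : omega v v = 0.
Proof. by rewrite /omega subrr. Qed.

Lemma dotDl (R : realType) (m : nat) (u v w : 'rV[R]_m) :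
  dot (u + v) w = dot u w + dot v w.
Proof. by rewrite /dot -big_split; apply: eq_bigr => k _; rewrite mxE mulrDl. Qed.

Lemma dotC (R : realType) (m : nat) (u v : 'rV[R]_m) : dot u v = dot v u.
Proof. by apply: eq_bigr => k _; rewrite mulrC. Qed.

Lemma dotZl (R : realType) (m : nat) (a : R) (u v : 'rV[R]_m) :
  dot (a *: u) v = a * dot u v.
Proof. by rewrite /dot mulr_sumr; apply: eq_bigr => k _; rewrite mxE mulrA. Qed.

Lemma omegaZl (R : realType) (m : nat) (a : R) (v w : 'rV[R]_(m + m)) :
  omega (a *: v) w = a * omega v w.
Proof.
by rewrite /omega !linearZ /= dotC !dotZl (dotC (lsubmx v)) mulrBr.
Qed.

Lemma omegaDr (R : realType) (m : nat) (u v w : 'rV[R]_(m + m)) :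
  omega u (v + w) = omega u v + omega u w.
Proof.
by rewrite /omega !linearD /= dotDl ![dot (rsubmx u) _]dotC dotDl opprD addrACA.
Qed.

Lemma omegaZr (R : realType) (m : nat) (a : R) (v w : 'rV[R]_(m + m)) :
  omega v (a *: w) = a * omega v w.
Proof.
by rewrite /omega !linearZ /= dotZl ![dot (rsubmx v) _]dotC dotZl mulrBr.
Qed.

(** The unit eigenspace of P is spanned by u, which P fixes, and by w, which P
    sends to w - T' u; on x u + y w the form b takes the value - y^2 T' E'. *)
Lemma neg_index_monodromy (R : realType) (m : nat) (P : 'M[R]_(m + m))
    (u w : 'rV[R]_(m + m)) (T' E' : R) :
  nondegenerate_autonomous P -> u *m (P - 1%:M) = 0 ->
  w *m (P - 1%:M) = - T' *: u -> omega u w = E' -> E' != 0 ->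
  neg_index (unit_eigenspace P) (bform P) = (0 < T' * E') :> nat.
Proof.
move=> nd uP wP uw E'_neq0.
have free : row_free (col_mx u w).
  apply: inj_row_free => d.
  rewrite -{1}(hsubmxK d) mul_row_col {1}[lsubmx d]mx11_scalar.
  rewrite {1}[rsubmx d]mx11_scalar !mul_scalar_mx.
  set a := lsubmx d 0 0; set c := rsubmx d 0 0 => comb0.
  have c0 : c = 0.
    have /eqP : omega u (a *: u + c *: w) = 0.
      by rewrite comb0 -(scale0r 0) omegaZr mul0r.
    rewrite omegaDr !omegaZr omega_self mulr0 add0r uw mulf_eq0.
    by rewrite (negPf E'_neq0) orbF => /eqP.
  have a0 : a = 0.
    have /eqP : omega (a *: u) w = 0.
      by move: comb0; rewrite c0 scale0r addr0 => ->;
        rewrite -(scale0r 0) omegaZl mul0r.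
    by rewrite omegaZl uw mulf_eq0 (negPf E'_neq0) orbF => /eqP.
  rewrite -(hsubmxK d) [lsubmx d]mx11_scalar [rsubmx d]mx11_scalar -/a -/c.
  by rewrite a0 c0 !raddf0 row_mx0.
have wPP : w *m (P - 1%:M) *m (P - 1%:M) = 0.
  by rewrite wP -scalemxAl uP scaler0.
have defN := plane_unit_eigenspace nd free uP wPP.
rewrite (neg_index_plane (beta := - (T' * E')) free defN) ?oppr_lt0 // => a c.
rewrite /bform mulmxDl -!scalemxAl uP wP scaler0 add0r scalerA.
by rewrite omegaZl omegaDr !omegaZr omega_self uw; ring.
Qed.

(** * Derivatives *)

Lemma derive_translation (R : realType) (V W : normedModType R) (f : V -> W)
    (a v s : V) : 'D_v (f \o shift s) a = 'D_v f (a + s).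
Proof.
by rewrite /derive; under eq_fun do rewrite /= -addrA.
Qed.

Lemma derivable_translation (R : realType) (W : normedModType R) (f : R -> W)
    (a s : R) : derivable f (a + s) 1 -> derivable (f \o shift s) a 1.
Proof.
by rewrite /derivable; under eq_fun do rewrite /= addrA.
Qed.

Lemma derive1_translation (R : realType) (W : normedModType R) (f : R -> W)
    (s : R) : derive1 (f \o shift s) = derive1 f \o shift s.
Proof.
by apply/funext => t; rewrite /= !derive1E derive_translation.
Qed.

Lemma is_derive_translation (R : realType) (W : normedModType R) (f : R -> W)
    (a s : R) (d : W) :
  is_derive (a + s) 1 f d -> is_derive a 1 (f \o shift s) d.
Proof.
move=> fd; apply: DeriveDef; first exact: derivable_translation.
by rewrite derive_translation derive_val.
Qed.

Lemma differentiable_row (R : realType) (V : normedModType R) (n : nat)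
    (f : V -> 'rV[R]_n) (z : V) :
  (forall k, differentiable (fun x => f x 0 k) z) -> differentiable f z.
Proof.
move=> fd.
have -> : f = \sum_(k < n) (fun x => f x 0 k *: delta_mx 0 k).
  by apply/funext => x; rewrite fct_sumE -row_sum_delta.
by apply: differentiable_sum => k; exact: differentiableZl.
Qed.

Lemma derive_comp_diff (R : realType) (U V W : normedModType R) (f : U -> V)
    (g : V -> W) (z v : U) :
  differentiable f z -> differentiable g (f z) ->
  'D_v (g \o f) z = 'D_('D_v f z) g (f z).
Proof.
move=> df dg; rewrite !deriveE //; first by rewrite diff_comp.
exact: differentiable_comp.
Qed.

Lemma derive_row (R : realType) (V : normedModType R) (n : nat)
    (f : V -> 'rV[R]_n) (z v : V) (k : 'I_n) :
  differentiable f z -> ('D_v f z) 0 k = 'D_v (fun x => f x 0 k) z.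
Proof. by move=> fd; rewrite derive_mx ?mxE //; exact: diff_derivable. Qed.

Lemma derive_lsubmx (R : realType) (V : normedModType R) (m n : nat)
    (f : V -> 'rV[R]_(m + n)) (z v : V) : differentiable f z ->
  lsubmx ('D_v f z) = 'D_v (lsubmx \o f) z.
Proof.
move=> df; rewrite [RHS]derive_comp_diff //; last exact: differentiable_lsubmx.
rewrite [RHS]deriveE; last exact: differentiable_lsubmx.
by rewrite diff_lin //; exact: continuous_lsubmx.
Qed.

Lemma derive_rsubmx (R : realType) (V : normedModType R) (m n : nat)
    (f : V -> 'rV[R]_(m + n)) (z v : V) : differentiable f z ->
  rsubmx ('D_v f z) = 'D_v (rsubmx \o f) z.
Proof.
move=> df; rewrite [RHS]derive_comp_diff //; last exact: differentiable_rsubmx.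
rewrite [RHS]deriveE; last exact: differentiable_rsubmx.
by rewrite diff_lin //; exact: continuous_rsubmx.
Qed.

Lemma derive_dot (R : realType) (V : normedModType R) (n : nat)
    (f g : V -> 'rV[R]_n) (z v : V) :
  differentiable f z -> differentiable g z ->
  is_derive z v (fun x => dot (f x) (g x))
    (dot ('D_v f z) (g z) + dot (f z) ('D_v g z)).
Proof.
move=> df dg.
have cd (h : V -> 'rV[R]_n) k : differentiable h z ->
    derivable (fun x => h x 0 k) z v.
  by move=> dh; move: k; have /diff_derivable/derivable_mxP := dh; apply.
have -> : (fun x => dot (f x) (g x))
    = \sum_(k < n) ((fun x => f x 0 k) * (fun x => g x 0 k)).
  by apply/funext => x; rewrite fct_sumE.
apply: is_derive_eq.
  apply: is_derive_sum => k; apply: is_deriveM; apply: derivableP; exact: cd.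
rewrite /dot -big_split /=; apply: eq_bigr => k _.
by rewrite !derive_row // addrC; congr (_ + _); exact: mulrC.
Qed.

(** A directional derivative is the scalar product with the gradient. *)
Lemma derive_dot_grad (R : realType) (n : nat) (g : 'rV[R]_n -> R)
    (x X : 'rV[R]_n) : differentiable g x ->
  'D_X g x = dot (\row_k 'D_(delta_mx 0 k) g x) X.
Proof.
move=> dg; rewrite deriveE // {1}(row_sum_delta X) linear_sum /dot.
by apply: eq_bigr => k _; rewrite linearZ mxE deriveE //= mulrC.
Qed.

Lemma derive_fst (R : realType) (U V W : normedModType R) (f : U -> V -> W)
    (x X : U) (v : V) :
  'D_(X, 0) (fun z : U * V => f z.1 z.2) (x, v) = 'D_X (fun y => f y v) x.
Proof.
rewrite /derive; congr (lim (_ @ 0^')); apply/funext => h /=.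
by rewrite scaler0 add0r.
Qed.

Lemma derive_snd (R : realType) (U V W : normedModType R) (f : U -> V -> W)
    (x : U) (v X : V) :
  'D_(0, X) (fun z : U * V => f z.1 z.2) (x, v) = 'D_X (f x) v.
Proof.
rewrite /derive; congr (lim (_ @ 0^')); apply/funext => h /=.
by rewrite scaler0 add0r.
Qed.

(** Total derivative of L in terms of its two partial gradients. *)
Lemma derive_gradients (R : realType) (m : nat) (L : 'rV[R]_m -> 'rV[R]_m -> R)
    (x v X V : 'rV[R]_m) :
  differentiable (fun z : 'rV[R]_m * 'rV[R]_m => L z.1 z.2) (x, v) ->
  'D_(X, V) (fun z : 'rV[R]_m * 'rV[R]_m => L z.1 z.2) (x, v) =
  dot (grad_x L x v) X + dot (grad_v L x v) V.
Proof.
move=> dL.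
have -> : (X, V) = (X, 0) + (0, V) :> 'rV[R]_m * 'rV[R]_m.
  by congr pair; rewrite ?addr0 ?add0r.
rewrite deriveE // linearD -!deriveE //; congr (_ + _).
  rewrite derive_fst derive_dot_grad //.
  have -> : (fun y => L y v) = (fun z : 'rV[R]_m * 'rV[R]_m => L z.1 z.2) \o
      (fun y => (y, v)) by [].
  by apply: differentiable_comp => //; apply: differentiable_pair.
rewrite derive_snd derive_dot_grad //.
have -> : L x = (fun z : 'rV[R]_m * 'rV[R]_m => L z.1 z.2) \o
    (fun u => (x, u)) by [].
by apply: differentiable_comp => //; apply: differentiable_pair.
Qed.

Lemma derive_pair (R : realType) (U V W : normedModType R) (f : U -> V)
    (g : U -> W) (z d : U) : differentiable f z -> differentiable g z ->
  'D_d (fun y => (f y, g y)) z = ('D_d f z, 'D_d g z).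
Proof.
move=> df dg; rewrite deriveE; last exact: differentiable_pair.
by rewrite diff_pair // !deriveE.
Qed.

(** The terms with the derivative of the velocity v cancel, because the momentum
    is the gradient of L with respect to the velocity. *)
Lemma derive_local_energy (R : realType) (V : normedModType R) (m : nat)
    (L : 'rV[R]_m -> 'rV[R]_m -> R) (x v : V -> 'rV[R]_m) (z d : V) :
  differentiable (fun y : 'rV[R]_m * 'rV[R]_m => L y.1 y.2) (x z, v z) ->
  differentiable x z -> differentiable v z ->
  differentiable (fun y => grad_v L (x y) (v y)) z ->
  'D_d (fun y => local_energy L (x y) (v y)) z =
  dot ('D_d (fun y => grad_v L (x y) (v y)) z) (v z) -
  dot (grad_x L (x z) (v z)) ('D_d x z).
Proof.
move=> dL dx dv dp.
have dxv : differentiable (fun y => (x y, v y)) z by exact: differentiable_pair.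
have dLxv : is_derive z d (fun y => L (x y) (v y))
    (dot (grad_x L (x z) (v z)) ('D_d x z) +
     dot (grad_v L (x z) (v z)) ('D_d v z)).
  apply: (@DeriveDef _ _ _ _ _
    ((fun y : 'rV[R]_m * 'rV[R]_m => L y.1 y.2) \o (fun y => (x y, v y)))).
    by apply: diff_derivable; exact: differentiable_comp.
  by rewrite derive_comp_diff // derive_pair // derive_gradients.
have de := is_deriveB (derive_dot d dp dv) dLxv.
have -> : (fun y => local_energy L (x y) (v y)) =
  (fun y => dot (grad_v L (x y) (v y)) (v y)) - (fun y => L (x y) (v y)) by [].
by rewrite (@derive_val _ _ _ _ _ _ _ de) opprD addrACA subrr addr0.
Qed.

(** Chain rule on both sides of Phi o zeta = zeta o ret at a fixed point of ret. *)
Lemma derive_semiconjugacy (R : realType) (V : normedModType R) (n : nat)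
    (zeta : V -> 'rV[R]_n) (Phi : 'rV[R]_n -> 'rV[R]_n) (ret : V -> V)
    (z v : V) :
  differentiable zeta z -> differentiable Phi (zeta z) ->
  differentiable ret z -> ret z = z ->
  (\forall y \near z, Phi (zeta y) = zeta (ret y)) ->
  'D_v zeta z *m 'J Phi (zeta z) = 'D_('D_v ret z) zeta z.
Proof.
move=> dzeta dPhi dret retz conj.
rewrite -deriveEjacobian // -(derive_comp_diff v dzeta dPhi).
rewrite (@near_eq_derive _ _ _ (Phi \o zeta) (zeta \o ret) _ _ conj).
by rewrite derive_comp_diff ?retz.
Qed.

(** Partial derivatives of a function of two real variables. *)
Lemma derive_coordinates (R : realType) (W : normedModType R) (f : R * R -> W)
    (z : R * R) (a b : R) : differentiable f z ->
  'D_(a, b) f z = a *: 'D_(1, 0) f z + b *: 'D_(0, 1) f z.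
Proof.
move=> df; rewrite !(deriveE _ df) -!linearZ -linearD; congr ('d f z _).
by congr pair => /=; rewrite [_ *: 1]mulr1 scaler0 ?addr0 ?add0r.
Qed.

(** * Trajectories and phase points *)

Lemma momentum_translation (R : realType) (m : nat) (M : manifold R m)
    (L : lagrangian M) (i : mindex M) (c : R -> M) (s t : R) :
  momentum L i (c \o shift s) t = momentum L i c (t + s).
Proof.
rewrite /momentum -[Defs.coord i _]/(Defs.coord i c \o shift s).
by rewrite derive1_translation.
Qed.

Lemma phase_translation (R : realType) (m : nat) (M : manifold R m)
    (L : lagrangian M) (i : mindex M) (c : R -> M) (s t : R) :
  phase L i (c \o shift s) t = phase L i c (t + s).
Proof. by rewrite /phase momentum_translation. Qed.

(** Trajectories of an autonomous system are invariant under time translation. *)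
Lemma trajectory_translation (R : realType) (m : nat) (M : manifold R m)
    (L : lagrangian M) (J : set R) (c : R -> M) (s : R) :
  trajectory L setT c -> trajectory L J (c \o shift s).
Proof.
move=> tc t _; have [cc cl] := tc (t + s) I; split.
  apply: continuous_comp => //.
  exact: (cvgD cvg_id (cvg_cst _)).
move=> i ci; have [d1 d2 EL] := cl i ci.
rewrite -[Defs.coord i _]/(Defs.coord i c \o shift s) derive1_translation.
split.
- exact: derivable_translation.
- exact: derivable_translation.
- have -> : momentum L i (c \o shift s) = momentum L i c \o shift s.
    by apply/funext => r; rewrite momentum_translation.
  exact: is_derive_translation.
Qed.

Lemma phase_periodic (R : realType) (m : nat) (M : manifold R m)
    (L : lagrangian M) (i : mindex M) (c : R -> M) (T t : R) :
  (forall s, c (s + T) = c s) -> phase L i c (t + T) = phase L i c t.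
Proof.
move=> cT; have cE : c \o shift T = c by apply/funext => s; exact: cT.
by rewrite -phase_translation cE.
Qed.

(** Position at z = (parameter, time) of a family c of curves, in the chart of
    index i.  Velocity, momentum and phase point follow the same convention; all
    are functions of the pair z so that they can be differentiated jointly. *)
Definition chart_position (R : realType) (m : nat) (M : manifold R m)
    (i : mindex M) (c : R -> R -> M) (z : R * R) : 'rV[R]_m :=
  Defs.coord i (c z.1) z.2.

(** Coordinate velocity of the family: the derivative with respect to time. *)
Definition chart_velocity (R : realType) (m : nat) (M : manifold R m)
    (i : mindex M) (c : R -> R -> M) (z : R * R) : 'rV[R]_m :=
  derive1 (Defs.coord i (c z.1)) z.2.

(** Momentum p = L_v of the family. *)
Definition chart_momentum (R : realType) (m : nat) (M : manifold R m)
    (L : lagrangian M) (i : mindex M) (c : R -> R -> M) (z : R * R) :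
  'rV[R]_m := grad_v (L i) (chart_position i c z) (chart_velocity i c z).

(** Phase point (x, p) of the family. *)
Definition chart_phase (R : realType) (m : nat) (M : manifold R m)
    (L : lagrangian M) (i : mindex M) (c : R -> R -> M) (z : R * R) :
  'rV[R]_(m + m) := phase L i (c z.1) z.2.

(** The velocity is a partial derivative of the position in the two variables,
    which is how it inherits the smoothness of the family. *)
Lemma chart_velocityE (R : realType) (m : nat) (M : manifold R m)
    (i : mindex M) (c : R -> R -> M) :
  chart_velocity i c = fun z => 'D_(0, 1) (chart_position i c) z.
Proof.
apply/funext => -[a t]; rewrite /chart_velocity derive1E /=.
by rewrite (derive_snd (fun a t => Defs.coord i (c a) t)).
Qed.

(** The symplectic form on two derivatives of a map y |-> (x, p), through the
    derivatives of x and p. *)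
Lemma omega_derive (R : realType) (V : normedModType R) (m : nat)
    (f : V -> 'rV[R]_(m + m)) (z v w : V) : differentiable f z ->
  omega ('D_v f z) ('D_w f z) =
  dot ('D_w (rsubmx \o f) z) ('D_v (lsubmx \o f) z) -
  dot ('D_v (rsubmx \o f) z) ('D_w (lsubmx \o f) z).
Proof.
move=> df; rewrite -(derive_rsubmx w df) -(derive_rsubmx v df).
by rewrite -(derive_lsubmx w df) -(derive_lsubmx v df).
Qed.

(** ** Periodic families near the base trajectory *)

Section Family.
Variables (R : realType) (m : nat) (M : manifold R m) (L : lagrangian M).
Variables (gamma : R -> M) (tau0 eps : R) (c : R -> R -> M) (tau E : R -> R).
Variable (i : mindex M).
Hypothesis family : periodic_family L gamma tau0 eps c tau E.
Hypothesis gi : cdom (mchart i) (gamma 0).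

Let dom00 : [set z : R * R | `|z.1| < eps /\ cdom (mchart i) (c z.1 z.2)] (0, 0).
Proof.
split => /=; first by rewrite normr0 (family_radius family).
by rewrite (family_init family).
Qed.

Lemma position_differentiable : differentiable (chart_position i c) (0, 0).
Proof. by have [+ _] := family_smooth family i 1; apply. Qed.

Lemma velocity_differentiable : differentiable (chart_velocity i c) (0, 0).
Proof.
rewrite chart_velocityE.
by have [_ /(_ (0, 1))[+ _]] := family_smooth family i 2; apply.
Qed.

Let image00 : [set z : 'rV[R]_m * 'rV[R]_m |
    (cmap (mchart i) @` cdom (mchart i)) z.1]
  (chart_position i c (0, 0), chart_velocity i c (0, 0)).
Proof.
by exists (gamma 0) => //; rewrite /chart_position /coord /= (family_init family).
Qed.

Lemma lagrangian_differentiable :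
  differentiable (fun z : 'rV[R]_m * 'rV[R]_m => L i z.1 z.2 : R)
    (chart_position i c (0, 0), chart_velocity i c (0, 0)).
Proof. by have [+ _] := lagrangian_smooth L i 1; apply. Qed.

Lemma momentum_differentiable : differentiable (chart_momentum L i c) (0, 0).
Proof.
apply: differentiable_row => k.
have -> : (fun z => chart_momentum L i c z 0 k) =
    (fun y => 'D_(0, delta_mx 0 k)
       (fun z : 'rV[R]_m * 'rV[R]_m => L i z.1 z.2 : R) y) \o
    (fun z => (chart_position i c z, chart_velocity i c z)).
  by apply/funext => z; rewrite /= derive_snd mxE.
apply: differentiable_comp.
  apply: differentiable_pair; first exact: position_differentiable.
  exact: velocity_differentiable.
have [_ /(_ (0, delta_mx 0 k))[+ _]] := lagrangian_smooth L i 2.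
by apply; exact: image00.
Qed.

Lemma phase_differentiable : differentiable (chart_phase L i c) (0, 0).
Proof.
apply: differentiable_row => k.
have -> : (fun z => chart_phase L i c z 0 k) = fun z =>
    match fintype.split k with
    | inl k1 => chart_position i c z 0 k1
    | inr k2 => chart_momentum L i c z 0 k2
    end by apply/funext => z; rewrite mxE.
case: (fintype.split k) => l.
  apply: (@differentiable_comp _ _ _ _ (chart_position i c) (fun x => x 0 l)).
    exact: position_differentiable.
  exact: differentiable_coord.
apply: (@differentiable_comp _ _ _ _ (chart_momentum L i c) (fun x => x 0 l)).
  exact: momentum_differentiable.
exact: differentiable_coord.
Qed.

(** At time tau0 the base trajectory is back at its initial point, so near (0, 0)
    both ends of the arc of duration tau0 starting at time t on the a-th
    trajectory lie in the domain of the chart. *)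
Lemma near_family_domain : \forall z \near ((0, 0) : R * R),
  [/\ `|z.1| < eps, cdom (mchart i) (c z.1 z.2) &
      cdom (mchart i) (c z.1 (z.2 + tau0))].
Proof.
have eps_gt0 := family_radius family.
have eps0 : `|0 : R| < eps by rewrite normr0.
have [_ _ gT] : periodic_trajectory L tau0 gamma.
  by have := family_periodic family eps0;
    rewrite (family_init family) (family_init_period family).
have near_dom t (f : R * R -> R) : f (0, 0) = t -> {for (0, 0), continuous f} ->
    cdom (mchart i) (gamma t) ->
    \forall z \near ((0, 0) : R * R), cdom (mchart i) (c z.1 (f z)).
  move=> f0 cf gt.
  have cont : (fun z : R * R => c z.1 (f z)) @ ((0, 0) : R * R) --> c 0 t.
    apply: (cvg_comp2 (h := c) cvg_fst cf).
    by rewrite f0; exact: (family_continuous family (t := t) eps0).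
  apply: (cont (cdom (mchart i))).
  apply: open_nbhs_nbhs; split; first exact: chart_open_dom.
  by rewrite (family_init family).
have near_eps : \forall z \near ((0, 0) : R * R), `|z.1| < eps.
  have near_eps1 : \forall a \near (0 : R), `|a| < eps.
    by apply: pseudometric_normed_Zmodule.nbhs0_lt.
  exact: (@filter_prod1 _ _ (nbhs (0 : R)) (nbhs (0 : R)) _ _ near_eps1).
have csnd : {for ((0, 0) : R * R), continuous (@snd R R)} by exact: cvg_snd.
have cshift : {for ((0, 0) : R * R), continuous (fun z : R * R => z.2 + tau0)}.
  exact: (cvgD cvg_snd (cvg_cst _)).
have near0 := near_dom 0 (@snd R R) erefl csnd gi.
have gtau0 : cdom (mchart i) (gamma tau0) by rewrite -[tau0]add0r gT.
have near_tau0 := near_dom tau0 _ (add0r tau0) cshift gtau0.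
by move: near_eps near0 near_tau0; apply: filterS3.
Qed.

(** The time-tau0 map sends zeta(a, t) to zeta(a, t + tau0), and the a-th
    trajectory is tau(a)-periodic.  Subtracting tau(a) brings the second argument
    back near 0, where the family is known to be differentiable. *)
Lemma time_map_chart_phase (Phi : 'rV[R]_(m + m) -> 'rV[R]_(m + m)) :
  time_map L i tau0 (phase L i gamma 0) Phi ->
  \forall z \near ((0, 0) : R * R),
    Phi (chart_phase L i c z) = chart_phase L i c (z.1, z.2 + tau0 - tau z.1).
Proof.
move=> flow.
have z0 : chart_phase L i c (0, 0) = phase L i gamma 0.
  by rewrite /chart_phase (family_init family).
have cont := differentiable_continuous phase_differentiable.
(* The time map is given by its graph near the initial phase point only; the
   continuity of the phase point carries this neighbourhood back to (0, 0). *)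
rewrite /time_map -{}z0 in flow.
move: near_family_domain (cont _ flow) => /=; apply: filterS2 => -[a t] /=.
move=> [a_eps ct cT] /(_ (chart_phase L i c (a, t + tau0 - tau a))) H.
apply/esym/H; exists (c a \o shift t), 1.
have [traj _ per] := family_periodic family a_eps.
have cdom0 : cdom (mchart i) ((c a \o shift t) 0) by rewrite /= add0r.
have cdomT : cdom (mchart i) ((c a \o shift t) tau0) by rewrite /= addrC.
have phase0 : phase L i (c a \o shift t) 0 = chart_phase L i c (a, t).
  by rewrite phase_translation add0r.
have phaseT : phase L i (c a \o shift t) tau0 =
    chart_phase L i c (a, t + tau0 - tau a).
  rewrite phase_translation addrC -[in LHS](subrK (tau a) (t + tau0)).
  exact: (phase_periodic L i (t + tau0 - tau a) per).
by split; [exact: ltr01 | exact: trajectory_translation | exact: conj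
  | exact: conj].
Qed.

(** Differential at (0, 0) of the map (a, t) |-> (a, t + tau0 - tau(a)), which
    fixes (0, 0). *)
Lemma return_is_diff :
  is_diff ((0, 0) : R * R) (fun z : R * R => (z.1, z.2 + tau0 - tau z.1))
    (fun v => (v.1, v.2 - v.1 * derive1 tau 0)).
Proof.
have eps0 : `|0 : R| < eps by rewrite normr0 (family_radius family).
have dtau : differentiable tau 0.
  by have [+ _] := family_period_smooth family 1; apply.
have dfst : is_diff ((0, 0) : R * R) fst fst.
  apply: DiffDef; first by apply: linear_differentiable => z; exact: cvg_fst.
  by rewrite diff_lin // => z; exact: cvg_fst.
have dsnd : is_diff ((0, 0) : R * R) snd snd.
  apply: DiffDef; first by apply: linear_differentiable => z; exact: cvg_snd.
  by rewrite diff_lin // => z; exact: cvg_snd.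
have dt : is_diff (fst ((0, 0) : R * R)) tau (fun h => h * derive1 tau 0).
  by apply: DiffDef => //; rewrite diff1E.
have := is_diff_pair dfst (is_diffB (is_diffD dsnd
  (is_diff_cst tau0 ((0, 0) : R * R))) (is_diff_comp dfst dt)).
move=> H; apply: (is_diff_eq H).
by apply/funext => v /=; rewrite !fctE addr0.
Qed.

Lemma omega_chart_phase (v w : R * R) :
  omega ('D_v (chart_phase L i c) (0, 0)) ('D_w (chart_phase L i c) (0, 0)) =
  dot ('D_w (chart_momentum L i c) (0, 0)) ('D_v (chart_position i c) (0, 0)) -
  dot ('D_v (chart_momentum L i c) (0, 0)) ('D_w (chart_position i c) (0, 0)).
Proof.
have positionE : lsubmx \o chart_phase L i c = chart_position i c.
  by apply/funext => z; rewrite /= /chart_phase /phase row_mxKl.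
have momentumE : rsubmx \o chart_phase L i c = chart_momentum L i c.
  by apply/funext => z; rewrite /= /chart_phase /phase row_mxKr.
by rewrite (omega_derive v w phase_differentiable) positionE momentumE.
Qed.

Lemma time_derive_position :
  'D_(0, 1) (chart_position i c) (0, 0) = chart_velocity i c (0, 0).
Proof. by rewrite chart_velocityE. Qed.

(** The Euler-Lagrange equation at time 0. *)
Lemma time_derive_momentum :
  'D_(0, 1) (chart_momentum L i c) (0, 0) =
  grad_x (L i) (chart_position i c (0, 0)) (chart_velocity i c (0, 0)).
Proof.
rewrite (derive_snd (fun a t => chart_momentum L i c (a, t))).
have eps0 : `|0 : R| < eps by rewrite normr0 (family_radius family).
have [traj _ _] := family_periodic family eps0.
have ci : cdom (mchart i) (c 0 0) by rewrite (family_init family).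
have [_ /(_ i ci)[_ _ EL]] := traj 0 I.
exact: (@derive_val _ _ _ _ _ _ _ EL).
Qed.

(** dH(w) = omega(u, w) with u the Hamiltonian vector field and w the derivative
    of the phase point along the family; and dH(w) = E'(0). *)
Lemma derive_energy :
  derive1 E 0 = omega ('D_(0, 1) (chart_phase L i c) (0, 0))
                      ('D_(1, 0) (chart_phase L i c) (0, 0)).
Proof.
rewrite (omega_chart_phase (0, 1) (1, 0)).
rewrite time_derive_position time_derive_momentum.
have -> : derive1 E 0 = 'D_(1, 0) (fun z => local_energy (L i)
    (chart_position i c z) (chart_velocity i c z)) (0, 0).
  rewrite (derive_fst (fun a t => local_energy (L i)
    (chart_position i c (a, t)) (chart_velocity i c (a, t)))).
  rewrite derive1E; apply: near_eq_derive.
  have cvg0 : (fun a : R => (a, 0 : R)) @ (0 : R) --> ((0, 0) : R * R).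
    exact: (cvg_pair cvg_id (cvg_cst _)).
  have near_dom : \forall a \near (0 : R),
    [/\ `|a| < eps, cdom (mchart i) (c a 0) & cdom (mchart i) (c a (0 + tau0))].
    exact: (cvg0 _ near_family_domain).
  apply: filterS near_dom => a [a_eps ca _].
  exact: (family_energy family a_eps ca).
apply: derive_local_energy.
- exact: lagrangian_differentiable.
- exact: position_differentiable.
- exact: velocity_differentiable.
- exact: momentum_differentiable.
Qed.

(** The action of the linear Poincare map on the derivatives of the phase point
    in any direction v of the (parameter, time) plane. *)
Lemma poincare_chart_phase (P : 'M[R]_(m + m)) (v : R * R) :
  linear_poincare L i tau0 gamma P ->
  'D_v (chart_phase L i c) (0, 0) *m P =
  'D_(v.1, v.2 - v.1 * derive1 tau 0) (chart_phase L i c) (0, 0).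
Proof.
move=> [_ [Phi [flow dPhi ->]]].
have z0 : chart_phase L i c (0, 0) = phase L i gamma 0.
  by rewrite /chart_phase (family_init family).
pose ret z : R * R := (z.1, z.2 + tau0 - tau z.1).
have ret0 : ret (0, 0) = (0, 0).
  by rewrite /ret /= (family_init_period family) add0r subrr.
have [dret dretE] := return_is_diff.
have dret_v : 'D_v ret (0, 0) = (v.1, v.2 - v.1 * derive1 tau 0).
  by rewrite (deriveE v dret) dretE.
rewrite -dret_v -z0; apply: derive_semiconjugacy.
- exact: phase_differentiable.
- by rewrite z0.
- exact: dret.
- exact: ret0.
- exact: time_map_chart_phase.
Qed.

Lemma poincare_time_derivative (P : 'M[R]_(m + m)) :
  linear_poincare L i tau0 gamma P ->
  'D_(0, 1) (chart_phase L i c) (0, 0) *m (P - 1%:M) = 0.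
Proof.
move=> Pp; rewrite mulmxBr mulmx1 (poincare_chart_phase (0, 1) Pp) /=.
by rewrite mul0r subr0 subrr.
Qed.

Lemma poincare_parameter_derivative (P : 'M[R]_(m + m)) :
  linear_poincare L i tau0 gamma P ->
  'D_(1, 0) (chart_phase L i c) (0, 0) *m (P - 1%:M) =
  - derive1 tau 0 *: 'D_(0, 1) (chart_phase L i c) (0, 0).
Proof.
move=> Pp; rewrite mulmxBr mulmx1 (poincare_chart_phase (1, 0) Pp) /=.
rewrite (derive_coordinates _ _ phase_differentiable).
by rewrite scale1r mul1r sub0r addrAC subrr add0r.
Qed.
End Family.

(** * The index of b *)

Theorem lemma6p4 (R : realType) (m : nat) (M : manifold R m)
    (L : lagrangian M) (gamma : R -> M) (tau0 : R)
    (i : mindex M) (P : 'M[R]_(m + m))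
    (eps : R) (gamma_ : R -> R -> M) (tau E : R -> R)
    (gamma_periodic : periodic_trajectory L tau0 gamma)
    (gamma_nonconstant : exists s t, gamma s <> gamma t)
    (P_poincare : linear_poincare L i tau0 gamma P)
    (gamma_nondegenerate : nondegenerate_autonomous P)
    (family : periodic_family L gamma tau0 eps gamma_ tau E)
    (dtau_neq0 : derive1 tau 0 != 0)
    (dE_dtau_neq0 : derive1 E 0 / derive1 tau 0 != 0) :
  (-1 : R) ^+ neg_index (unit_eigenspace P) (bform P) =
    - Num.sg (derive1 tau 0 * derive1 E 0) /\
  - Num.sg (derive1 tau 0 * derive1 E 0) = - Num.sg (derive1 E 0 / derive1 tau 0).
Proof.
have [gi _] := P_poincare.
have dE_neq0 : derive1 E 0 != 0.
  by apply: contraNneq dE_dtau_neq0 => ->; rewrite mul0r.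
rewrite (neg_index_monodromy gamma_nondegenerate
  (poincare_time_derivative family gi P_poincare)
  (poincare_parameter_derivative family gi P_poincare)
  (esym (derive_energy family gi)) dE_neq0).
split; last by rewrite !sgrM sgrV mulrC.
have: derive1 tau 0 * derive1 E 0 != 0 by rewrite mulf_neq0.
case: (ltgtP 0 (derive1 tau 0 * derive1 E 0)) => [pos|neg|//] _.
- by rewrite (gtr0_sg pos) expr1.
- by rewrite (ltr0_sg neg) expr0 opprK.
Qed.
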